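(* Let $S\subseteq R_n\setminus\{e\}$ be an inverse-closed set of rotations of $D_{2n}$ with $|S|=2k<n$ for some integer $k\ge 2$. Choose representatives $a_1,\dots,a_k\in\mathbb{Z}_n$ such that $S=\{r^{\pm a_1},\dots,r^{\pm a_k}\}$. Let $T=\{\pm a_1,\dots,\pm a_k\}\subseteq\mathbb{Z}_n$, $G_1=\mathrm{Cay}(D_{2n},S)$, $G_2=\mathrm{Cay}(\mathbb{Z}_n,T)$, and $d=\gcd(n,a_1,\dots,a_k)$. Then: (1) $\mathrm{Cay}(D_{2n},S)\cong \mathrm{Cay}(\mathbb{Z}_n,T)+\mathrm{Cay}(\mathbb{Z}_n,T)$. (2) If $d=1$, then $G_2$ is connected; so $G_1$ has $2$ connected components, each isomorphic to $G_2$. (3) If $d>1$, write $n=dn'$ and $a_i=da_i'$ for all $i$, and set $T'=\{\pm a_1',\dots,\pm a_k'\}\subset\mathbb{Z}_{n'}$. Then $G_2$ decomposes into $d$ connected components, each isomorphic to $\mathrm{Cay}(\mathbb{Z}_{n'},T')$. So $G_1\cong G_2+G_2$ splits into $2d$ connected components, each isomorphic to $\mathrm{Cay}(\mathbb{Z}_{n'},T')$.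
   Context: $D_{2n}=\langle r,s\mid r^n=e,\ s^2=e,\ srs=r^{-1}\rangle$ is the dihedral group of order $2n$, and $R_n=\{r^i: i\in\mathbb{Z}_n\}$ is its set of rotations. $\mathbb{Z}_n$ is the additive cyclic group of order $n$. For a group $G$ and an inverse-closed subset $S\subseteq G\setminus\{e\}$, the undirected Cayley graph $\mathrm{Cay}(G,S)$ has vertex set $G$, with $u,v$ adjacent if and only if $uv^{-1}\in S$ (for $\mathbb{Z}_n$, written additively: $u-v\in T$). For graphs $\Gamma_1,\Gamma_2$, $\Gamma_1+\Gamma_2$ denotes their disjoint union. In computing gcds, elements of $\mathbb{Z}_n$ are identified with integer representatives. *)

(* Defs.v *)
From HB Require Import structures.
From mathcomp Require Import all_boot all_order all_algebra all_fingroup all_solvable.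

Set Implicit Arguments.
Unset Strict Implicit.
Unset Printing Implicit Defensive.

Import GRing.Theory.
Local Open Scope ring_scope.

(* A graph is a finite vertex type with an adjacency relation; the Cayley     *)
(* graphs below are symmetric and irreflexive, see cayley_sym and             *)
(* cayley_irrefl.                                                             *)

(* 'D_(n.*2) has order 2n when n > 1, so that generators satisfying the       *)
(* three relations are exactly the pairs (r, s) giving the presentation       *)
(* < r, s | r^n = e, s^2 = e, s r s = r^-1 >.                                 *)
Definition dihedral_generators (n : nat) (r s : 'D_(n.*2)) : Prop :=
  [/\ <<[set r; s]>>%g = [set: 'D_(n.*2)],
      (r ^+ n = 1)%g, (s ^+ 2 = 1)%g & (s * r * s = r^-1)%g].

(* 'Z_n is the cyclic group of order n only for n > 1; it denotes Z/2 for     *)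
(* n = 0, 1.                                                                  *)
Definition rotation_set (gT : finGroupType) (n : nat) (r : gT) : {set gT} :=
  [set (r ^+ (i : nat))%g | i : 'Z_n].

Definition inverse_closed (gT : finGroupType) (S : {set gT}) : Prop :=
  forall x : gT, x \in S -> (x^-1)%g \in S.

Definition pm_rotations (gT : finGroupType) (n k : nat) (r : gT)
    (a : 'I_k -> 'Z_n) : {set gT} :=
  [set (r ^+ (a i : nat))%g | i : 'I_k]
    :|: [set ((r ^+ (a i : nat))^-1)%g | i : 'I_k].

Definition pm_set (V : finZmodType) (k : nat) (a : 'I_k -> V) : {set V} :=
  [set a i | i : 'I_k] :|: [set - a i | i : 'I_k].

Definition cayley (gT : finGroupType) (S : {set gT}) : rel gT :=
  fun u v => (u * v^-1)%g \in S.

Definition cayleyZ (V : finZmodType) (T : {set V}) : rel V :=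
  fun u v => u - v \in T.

Definition graph_iso (V1 V2 : finType) (e1 : rel V1) (e2 : rel V2) : Prop :=
  exists2 f : V1 -> V2, bijective f & forall x y, e2 (f x) (f y) = e1 x y.

Definition graph_sum (V1 V2 : finType) (e1 : rel V1) (e2 : rel V2) :
    rel (V1 + V2)%type :=
  fun x y => match x, y with
             | inl x1, inl y1 => e1 x1 y1
             | inr x2, inr y2 => e2 x2 y2
             | _, _ => false
             end.

Definition graph_connected (V : finType) (e : rel V) : Prop :=
  (0 < #|V|)%N /\ forall x y : V, connect e x y.

Definition components (V : finType) (e : rel V) : {set {set V}} :=
  equivalence_partition (connect e) [set: V].

Definition induced (V : finType) (e : rel V) (C : {set V}) :
    rel {x : V | x \in C} :=
  fun x y => e (val x) (val y).

Definition splits_into (V W : finType) (e : rel V) (m : nat) (h : rel W) :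
    Prop :=
  #|components e| = m /\
  forall C : {set V}, C \in components e -> graph_iso (@induced V e C) h.

Lemma cayley_sym (gT : finGroupType) (S : {set gT}) :
  inverse_closed S -> symmetric (cayley S).
Proof.
move=> Sinv u v; rewrite /cayley.
by apply/idP/idP => /Sinv; rewrite invMg invgK.
Qed.

Lemma cayley_irrefl (gT : finGroupType) (S : {set gT}) :
  1%g \notin S -> irreflexive (cayley S).
Proof. by move=> S1 u; rewrite /cayley mulgV; apply: negbTE. Qed.

Lemma dihedral_generators_exist (n : nat) :
  (1 < n)%N -> exists r s : 'D_(n.*2), dihedral_generators r s.
Proof.
move=> n1; have := homg_refl [set: 'D_(n.*2)].
rewrite (Grp_dihedral n1) => /existsP[[x y]].
move=> /= /eqP[D xn y2 xy].
exists x, y; split=> //; first by rewrite -D /= joing_idl joing_idr.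
have yV : (y^-1 = y)%g by apply/eqP; rewrite eq_invg_mul -expg2 y2.
by rewrite -xy conjgE yV mulgA.
Qed.

(* Main.v *)
Require Import Defs.
From HB Require Import structures.
From mathcomp Require Import all_boot all_order all_algebra all_fingroup all_solvable.
Import GRing.Theory.
Local Open Scope ring_scope.

(** Everything follows from one decomposition.  Let [g] be an element of order
    [m] in a finite group [G], and let [S] be the set of the [g ^+ x] for [x] in
    a subset [T] of Z_m.  If [u] and [v] are adjacent in Cay(G, S) then
    [u * v^-1] lies in [<[g]>], so edges stay inside right cosets of [<[g]>].
    If [t] represents a coset, [x |-> g ^+ x * t] is a bijection from Z_m to that
    coset, and [(g ^+ x * t) * (g ^+ y * t)^-1 = g ^+ (x - y)], so each coset
    carries a copy of Cay(Z_m, T).  Hence Cay(G, S) is the disjoint union of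
    #|G| / m copies of Cay(Z_m, T) ([cayley_pm_copies]).

    It is applied to three pairs:
    - in the dihedral group, [r] has order [n] ([order_rotation]), which gives
      two copies of Cay(Z_n, T);
    - in Z_n seen as a multiplicative group, the [d]-th power of the generator 1
      has order [n' = n / d], which gives [d] copies of Cay(Z_n', T');
    - in the dihedral group, [r ^+ d] has order [n'], which gives [2 * d] copies
      of Cay(Z_n', T').
    In the last two the exponents [a_i = d * a'_i] are absorbed into the base
    by [pm_rotations_scale].

    The copies are the connected components as soon as the copied graph is
    connected ([copies_splits_into]).  For Cay(Z_m, +-z_i) this holds when the
    gcd of [m] and the [z_i] is 1, by Bezout ([pm_cayley_connected]).  That gcd
    is 1 after division by [d], since gcds scale.

    Finally the [k] representatives exist because [|S|] is even: [S] is stable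
    under inversion, which fixes at most one rotation other than the identity,
    hence none in [S] by parity ([pm_rotations_exists]). *)

(** * Graph isomorphisms and disjoint copies of a graph *)

Lemma graph_iso_sym (V1 V2 : finType) (e1 : rel V1) (e2 : rel V2) :
  graph_iso e1 e2 -> graph_iso e2 e1.
Proof.
case=> f [g fK gK] fe; exists g; first by exists f.
by move=> x y; rewrite -fe !gK.
Qed.

Lemma graph_iso_trans (V1 V2 V3 : finType) (e1 : rel V1) (e2 : rel V2)
    (e3 : rel V3) :
  graph_iso e1 e2 -> graph_iso e2 e3 -> graph_iso e1 e3.
Proof.
move=> [f fbij fe] [g gbij ge]; exists (g \o f); first exact: bij_comp.
by move=> x y; rewrite /= ge fe.
Qed.

(** The disjoint union of [m] copies of [h]; unlike [graph_sum], the number of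
    copies is a parameter. *)
Definition copies (m : nat) (W : finType) (h : rel W) : rel ('I_m * W) :=
  fun p q => (p.1 == q.1) && h p.2 q.2.

Arguments copies m {W} h.

Lemma copies_sum (W : finType) (h : rel W) :
  graph_iso (copies 2 h) (graph_sum h h).
Proof.
pose f (p : 'I_2 * W) := if p.1 == ord0 then inl p.2 else inr p.2 : (W + W)%type.
have ordE (i : 'I_2) : i = if i == ord0 then ord0 else ord_max.
  by case: i => [[|[|i]] ?] //; apply: val_inj.
exists f.
  exists (fun x => match x with inl w => (ord0, w) | inr w => (ord_max, w) end).
    by case=> i w; rewrite /f /= (ordE i); case: (i == ord0).
  by case.
move=> [i x] [j y]; rewrite /copies /f /= (ordE i) (ordE j).
by case: (i == ord0); case: (j == ord0).
Qed.

Lemma connect_copy (V W : finType) (e : rel V) (h : rel W) (f : W -> V) :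
  (forall x y, h x y -> e (f x) (f y)) ->
  forall x y, connect h x y -> connect e (f x) (f y).
Proof.
move=> fe x y /connectP[p]; elim: p x => [x _ -> //|z p IHp x /= /andP[hxz pz] yp].
by apply: connect_trans (connect1 (fe _ _ hxz)) (IHp _ pz yp).
Qed.

(** An edge never leaves its copy and [h] is connected, so reachability is
    equality of copy indices.  The components are therefore the [m] blocks of
    constant index, and these are distinct because [h] has a vertex. *)
Lemma copies_splits_into (V W : finType) (e : rel V) (m : nat) (h : rel W) :
  graph_iso (copies m h) e -> graph_connected h -> splits_into e m h.
Proof.
case=> f [g fK gK] fe [W0 hconn].
have connE x y : connect e x y = ((g x).1 == (g y).1).
  apply/idP/idP => [/connectP[p]|/eqP gxy].
    elim: p x => [x _ -> //|z p IHp x /= /andP[exz pz] yp].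
    have: copies m h (g x) (g z) by rewrite -fe !gK.
    by case/andP=> /eqP-> _; apply: IHp.
  rewrite -(gK x) -(gK y); case: (g x) (g y) gxy => [i u] [j v] /= <-.
  apply: (@connect_copy V W e h (fun w => f (i, w))); last exact: hconn.
  by move=> u' v' huv; rewrite fe /copies eqxx.
pose blk i := [set x : V | (g x).1 == i].
have compE : components e = [set blk i | i : 'I_m].
  apply/setP=> C; apply/imsetP/imsetP=> [[x _ ->]|[i _ ->]].
    exists (g x).1 => //; apply/setP=> y.
    by rewrite !inE connE eq_sym.
  case/card_gt0P: W0 => w _; exists (f (i, w)) => //; apply/setP=> y.
  by rewrite !inE connE fK eq_sym.
split.
  rewrite compE card_imset ?card_ord // => i j /setP eq_ij.
  case/card_gt0P: W0 => w _; have:= eq_ij (f (i, w)).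
  by rewrite !inE fK /= eqxx => /esym/eqP.
move=> C; rewrite compE => /imsetP[i _ ->].
have in_blk x : x \in blk i -> (g x).1 = i by rewrite inE => /eqP.
have fi w : f (i, w) \in blk i by rewrite inE fK.
exists (fun x => (g (val x)).2).
  exists (fun w => Sub (f (i, w)) (fi w)) => [x|w]; last by rewrite SubK fK.
  apply: val_inj; rewrite SubK.
  by rewrite -{1}(in_blk _ (valP x)) -surjective_pairing gK.
move=> x y; rewrite /induced -{2}(gK (val x)) -{2}(gK (val y)) fe /copies.
by rewrite (in_blk _ (valP x)) (in_blk _ (valP y)) eqxx.
Qed.

(** * Powers of a group element with exponents modulo its order *)

(** In 'Z_m the value of a sum, an opposite or a numeral is reduced modulo [m].
    The condition [g ^+ m = 1] makes the reduction invisible to powers of [g],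
    so that [x |-> g ^+ x] is a morphism from Z_m. *)
Lemma expg_ZpD (gT : finGroupType) (m : nat) (g : gT) (x y : 'Z_m) :
  (1 < m)%N -> (g ^+ m = 1 -> g ^+ (x + y)%R = g ^+ x * g ^+ y)%g.
Proof.
move=> m1 gm; have gm' : (g ^+ (Zp_trunc m).+2 = 1)%g by rewrite Zp_cast.
by rewrite /= (expg_mod _ gm') expgD.
Qed.

Lemma expg_ZpN (gT : finGroupType) (m : nat) (g : gT) (x : 'Z_m) :
  (1 < m)%N -> (g ^+ m = 1 -> g ^+ (- x)%R = (g ^+ x)^-1)%g.
Proof.
move=> m1 gm; apply/eqP; rewrite eq_sym eq_invg_mul -expg_ZpD //.
by rewrite subrr expg0.
Qed.

Lemma expg_Zp_inj (gT : finGroupType) (m : nat) (g : gT) :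
  (1 < m)%N -> #[g]%g = m -> injective (fun x : 'Z_m => g ^+ x)%g.
Proof.
move=> m1 og x y /eqP; rewrite eq_expg_mod_order og => /eqP.
rewrite !modn_small; first exact: val_inj.
  by rewrite -[X in (_ < X)%N](Zp_cast m1).
by rewrite -[X in (_ < X)%N](Zp_cast m1).
Qed.

Lemma expg_Zp_nat (gT : finGroupType) (m : nat) (g : gT) (j : nat) :
  (1 < m)%N -> (g ^+ m = 1 -> g ^+ (j%:R : 'Z_m)%R = g ^+ j)%g.
Proof. by move=> m1 gm; rewrite val_Zp_nat // expg_mod. Qed.

Lemma expg_Zp_int_scale (gT : finGroupType) (n d m : nat) (g : gT) (z : int) :
  (1 < m)%N -> (1 < n)%N -> n = (d * m)%N -> (g ^+ n = 1)%g ->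
  (g ^+ ((d%:Z * z)%:~R : 'Z_n) = g ^+ d ^+ (z%:~R : 'Z_m))%g.
Proof.
move=> m1 n1 def_n gn; have gdm : (g ^+ d ^+ m = 1)%g by rewrite -expgM -def_n.
have nat_case (j : nat) :
    (g ^+ ((d%:Z * j%:Z)%:~R : 'Z_n) = g ^+ d ^+ (j%:~R : 'Z_m))%g.
  by rewrite -PoszM -!pmulrn !expg_Zp_nat // expgM.
case: z => j; first exact: nat_case.
by rewrite NegzE mulrN !intrN !expg_ZpN // nat_case.
Qed.

(** Multiples of [d] modulo [d * m], used as exponents of [g], are the same as
    residues modulo [m] used as exponents of [g ^+ d]. *)
Lemma pm_rotations_scale (gT : finGroupType) (n d m k : nat) (g : gT)
    (a : 'I_k -> 'Z_n) (z : 'I_k -> int) :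
  (1 < m)%N -> (1 < n)%N -> n = (d * m)%N -> (g ^+ n = 1)%g ->
  (forall i, (d%:Z * z i)%:~R = a i) ->
  pm_rotations g a
    = pm_rotations (g ^+ d)%g (fun i => (z i)%:~R : 'Z_m).
Proof.
move=> m1 n1 def_n gn def_a.
have E i : (g ^+ a i = g ^+ d ^+ ((z i)%:~R : 'Z_m))%g.
  by rewrite -def_a; apply: expg_Zp_int_scale.
by rewrite /pm_rotations; congr (_ :|: _); apply: eq_imset => i; rewrite E.
Qed.

(** Makes the additive Cayley graph of Z_n an instance of the multiplicative
    one, with the ring unit 1 (not the neutral element of the group) as the
    generator. *)
Lemma pm_rotations_Zp1 (n k : nat) (a : 'I_k -> 'Z_n) :
  pm_rotations (1%R : 'Z_n) a = pm_set a.
Proof.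
have E (x : 'Z_n) : ((1%R : 'Z_n) ^+ x)%g = x by exact: natr_Zp.
by rewrite /pm_rotations /pm_set; congr (_ :|: _); apply: eq_imset => i; rewrite E.
Qed.

Lemma pm_rotations_image (gT : finGroupType) (m k : nat) (g : gT)
    (b : 'I_k -> 'Z_m) :
  (1 < m)%N -> (g ^+ m = 1)%g ->
  pm_rotations g b = [set (g ^+ (x : nat))%g | x : 'Z_m in pm_set b].
Proof.
move=> m1 gm; rewrite /pm_rotations /pm_set imsetU -!imset_comp.
by congr (_ :|: _); apply: eq_imset => i; rewrite /= ?expg_ZpN.
Qed.

(** * Decomposition of a Cayley graph along the cosets of a cyclic subgroup *)

(** The copies are indexed by the right cosets of [<[g]>], each identified with
    Z_m through [x |-> g ^+ x * t] for a representative [t].  In the quotient of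
    two points of the same coset the representatives cancel; quotients of points
    of different cosets are outside [<[g]>], which contains the connection
    set. *)
Lemma cayley_pm_copies (gT : finGroupType) (g : gT) (c m k : nat)
    (b : 'I_k -> 'Z_m) :
  (1 < m)%N -> #[g]%g = m -> #|gT| = (c * m)%N ->
  graph_iso (copies c (cayleyZ (pm_set b)))
            (cayley (pm_rotations g b)).
Proof.
move=> m1 og cardG; have gm : (g ^+ m = 1)%g by rewrite -og expg_order.
have -> : c = #|rcosets <[g]> [set: gT]|.
  rewrite -[RHS]/(#|[set: gT] : <[g]>|%g) -divgS ?subsetT // cardsT cardG.
  by rewrite -orderE og mulnK ?(ltnW m1).
set R := rcosets _ _.
pose t (i : 'I_#|R|) := repr (enum_val i).
have cosE i : enum_val i = (<[g]> :* t i)%g.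
  by have /rcosetsP[x _ E] := enum_valP i; rewrite /t E rcoset_repr.
pose f (p : 'I_#|R| * 'Z_m) := (g ^+ p.2 * t p.1)%g.
have quotE p q :
    (f p * (f q)^-1 = g ^+ p.2 * (t p.1 * (t q.1)^-1) * (g ^+ q.2)^-1)%g.
  by rewrite /f invMg !mulgA.
have index_eq p q : (f p * (f q)^-1 \in <[g]>)%g -> p.1 = q.1.
  rewrite quotE groupMr ?groupV ?mem_cycle // groupMl ?mem_cycle // => tpq.
  by apply: enum_val_inj; rewrite !cosE; apply/rcoset_eqP; rewrite mem_rcoset.
exists f.
  apply: inj_card_bij => [p q fpq|].
    have i_eq : p.1 = q.1 by apply: index_eq; rewrite fpq mulgV.
    move: fpq; rewrite /f i_eq => /mulIg/(expg_Zp_inj _ _ _ m1 og) x_eq.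
    by rewrite (surjective_pairing p) (surjective_pairing q) i_eq x_eq.
  rewrite card_prod !card_ord Zp_cast // -og /order mulnC.
  by rewrite /R Lagrange ?subsetT ?cardsT.
move=> p q; rewrite /copies /cayley.
have [pq|neq_pq] /= := eqVneq p.1 q.1.
  rewrite quotE pq mulgV mulg1 -expg_ZpN // -expg_ZpD //.
  by rewrite pm_rotations_image // (mem_imset _ _ (expg_Zp_inj _ _ _ m1 og)).
apply: contraNF neq_pq => in_S; apply/eqP/index_eq.
by case/setUP: in_S => /imsetP[i _ ->]; rewrite ?groupV mem_cycle.
Qed.

(** * Connectedness of circulant graphs *)

(** The translations [x] that join every vertex [y] to [y + x] are closed under
    sums, hence under multiples, so they form an ideal of 'Z_m.  It contains [m]
    and the [z i], hence their gcd 1 by Bezout, hence everything. *)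
Lemma pm_cayley_connected (m k : nat) (z : 'I_k -> int) :
  (1 < m)%N -> gcdn m (\big[gcdn/0%N]_(i < k) `|z i|%N) = 1%N ->
  graph_connected (cayleyZ (pm_set (fun i => (z i)%:~R : 'Z_m))).
Proof.
move=> m1 gcd1; set T := pm_set _; split; first by apply/card_gt0P; exists 0.
pose P (x : 'Z_m) := forall y, connect (cayleyZ T) y (y + x).
have PD x y : P x -> P y -> P (x + y).
  by move=> Px Py u; rewrite addrA; apply: connect_trans (Px u) (Py _).
have PM x c : P x -> P (c * x).
  (* Reading [c] as a natural number turns [c * x] into an iterated sum. *)
  move=> Px; rewrite -(natr_Zp c) mulr_natl.
  elim: (c : nat) => [u|j IHj]; first by rewrite mulr0n addr0.
  by rewrite mulrS; apply: PD.
have PT i : P (z i)%:~R.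
  move=> u; rewrite connect1 // /cayleyZ opprD addNKr.
  by apply/setUP; right; apply/imsetP; exists i.
pose Q (j : nat) := P (j%:R).
have Qgcd i j : Q i -> Q j -> Q (gcdn i j).
  move=> Qi Qj; case: (posnP i) => [->|i_gt0]; first by rewrite gcd0n.
  case: (egcdnP j i_gt0) => u v uv _.
  rewrite /Q; have -> : (gcdn i j)%:R = u%:R * i%:R + - v%:R * j%:R :> 'Z_m.
    by rewrite mulNr -!natrM uv natrD addrAC subrr add0r.
  by apply: PD; apply: PM.
have P1 : P 1.
  rewrite -[1]/(1%:R) -gcd1; apply: (Qgcd).
    by rewrite /Q pchar_Zp // => u; rewrite addr0.
  elim/big_ind: _ => [|i j|i _]; first by move=> u; rewrite addr0.
    exact: Qgcd.
  case: (z i) (PT i) => j // /(PM _ (-1)).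
  by rewrite mulN1r NegzE intrN opprK.
by move=> x y; rewrite -[y](subrK x) addrC -[y - x]mulr1; apply: PM.
Qed.

(** * The rotations of the dihedral group *)

(** [s] normalises [<[r]>], so the whole group is [<[r]> * <[s]>] and has at most
    [#[r] * 2] elements; as it has [2 * n], the order of [r] cannot be a proper
    divisor of [n]. *)
Lemma order_rotation (n : nat) (r s : 'D_(n.*2)) :
  (1 < n)%N -> dihedral_generators r s -> #[r]%g = n.
Proof.
move=> n1 [gen rn s2 srs]; apply/eqP.
rewrite eqn_leq dvdn_leq ?order_dvdn ?rn ?(ltnW n1) //=.
have sV : (s^-1 = s)%g by apply/eqP; rewrite eq_invg_mul -expg2 s2.
have nrs : (<[s]> \subset 'N(<[r]>))%g.
  by rewrite cycle_subG; apply/normP; rewrite -cycleJ conjgE sV mulgA srs cycleV.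
have le_prod : (n.*2 <= #[r]%g * #[s]%g)%N.
  rewrite -[X in (X <= _)%N](card_dihedral n1) -gen.
  have -> : <<[set r; s]>>%g = (<[r]> <*> <[s]>)%g by rewrite joing_idl joing_idr.
  by rewrite (norm_joinEr nrs) mul_cardG leq_pmulr ?cardG_gt0.
rewrite -leq_double; apply: leq_trans le_prod _.
by rewrite -[X in (_ <= X)%N]muln2 leq_mul2l dvdn_leq ?orbT // order_dvdn s2.
Qed.

(** Split the exponents [U] of [S] by comparing [x] with [- x] as integers: [H]
    is the half with [x < - x], its negative is the other half, and [F] is the
    set of self-opposite exponents.  Since [0] is not in [U], the only possible
    element of [F] is [n / 2], and parity of [|U| = 2 * k] rules it out.  The
    representatives are the [k] elements of [H]. *)
Lemma pm_rotations_exists (gT : finGroupType) (n k : nat) (r : gT)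
    (S : {set gT}) :
  (1 < n)%N -> #[r]%g = n ->
  S \subset rotation_set n r :\ 1%g -> inverse_closed S ->
  #|S| = (2 * k)%N -> exists a : 'I_k -> 'Z_n, S = pm_rotations r a.
Proof.
move=> n1 or hS hSinv hcard.
have rn : (r ^+ n = 1)%g by rewrite -or expg_order.
have inj := expg_Zp_inj _ _ _ n1 or.
pose U := [set x : 'Z_n | (r ^+ x)%g \in S].
have SE : S = [set (r ^+ x)%g | x : 'Z_n in U].
  apply/setP=> y; apply/idP/imsetP => [Sy|[x]]; last by rewrite inE => Sx ->.
  have /setD1P[_ /imsetP[x _ yx]] := subsetP hS _ Sy.
  by exists x; rewrite // inE -yx.
have UN x : (- x \in U) = (x \in U).
  by rewrite !inE expg_ZpN //; apply/idP/idP=> /hSinv; rewrite ?invgK.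
have cardU : #|U| = (2 * k)%N by rewrite -hcard SE card_imset.
have U0 : 0 \notin U.
  rewrite inE expg0; apply/negP => S1.
  by have := subsetP hS _ S1; rewrite !inE eqxx.
move: {hS hSinv hcard} U SE UN cardU U0 => U SE UN cardU U0.
pose H := [set x in U | (x < - x)%N].
pose F := [set x in U | x == - x].
have NH : [set - x | x in H] = [set x in U | (- x < x)%N].
  apply/setP=> x; apply/imsetP/idP => [[y]|].
    by rewrite !inE => /andP[Uy lty] ->; rewrite opprK lty UN Uy.
  rewrite inE => /andP[Ux ltx]; exists (- x); last by rewrite opprK.
  by rewrite inE UN Ux opprK.
have UE : U = H :|: [set - x | x in H] :|: F.
  rewrite NH; apply/setP=> x; rewrite !in_setU !inE -!andb_orr -(inj_eq val_inj).
  by case: ltngtP; rewrite ?andbT.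
have F_le1 : (#|F| <= 1)%N.
  have dbl x : x \in F -> (x + x)%N = n.
    rewrite !inE => /andP[Ux /eqP xN].
    have x0 : x != 0 by apply: contraNneq U0 => <-.
    have xn : (x < n)%N by rewrite -[X in (_ < X)%N](Zp_cast n1).
    (* As [x] is nonzero, [n - x] is already reduced modulo [n]. *)
    have /eqP: (n - x)%N = x.
      have {2}-> : (x : nat) = ((n - x) %% n)%N.
        by rewrite {1}xN; congr ((_ - _) %% _)%N; apply: Zp_cast.
      rewrite modn_small // ltn_subrL (ltnW n1) andbT.
      by rewrite lt0n.
    by rewrite -(eqn_add2r x) subnK ?(ltnW xn) // => /eqP.
  apply/card_le1_eqP=> x y /dbl xx /dbl yy; apply: val_inj; apply: double_inj.
  by rewrite -!addnn xx yy.
have [cardH cardF] : #|H| = k /\ #|F| = 0%N.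
  have cU : (#|U| = #|H| + #|H| + #|F|)%N.
    have disj1 : [disjoint H & [set - x | x in H]].
      rewrite NH -setI_eq0; apply/eqP/setP=> x; rewrite !inE.
      by case: ltngtP; rewrite ?andbF.
    have disj2 : [disjoint H :|: [set - x | x in H] & F].
      rewrite NH -setI_eq0; apply/eqP/setP=> x; rewrite !inE -(inj_eq val_inj).
      by case: ltngtP; rewrite ?andbF.
    have NHcard : #|[set - x | x in H]| = #|H|.
      by rewrite card_imset //; apply: oppr_inj.
    by rewrite {1}UE !cardsU !disjoint_setI0 // !cards0 !subn0 NHcard.
  move: cU; rewrite cardU mul2n addnn; case: (#|F|) F_le1 => [|[|//]] _.
    by rewrite addn0 => /double_inj.
  by rewrite addn1 => /(congr1 odd); rewrite /= !odd_double.
pose a (i : 'I_k) : 'Z_n := enum_val (cast_ord (esym cardH) i).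
have HE : [set a i | i : 'I_k] = H.
  apply/setP=> x; apply/imsetP/idP => [[i _ ->]|Hx]; first exact: enum_valP.
  exists (cast_ord cardH (enum_rank_in Hx x)) => //.
  by rewrite /a cast_ordK enum_rankK_in.
exists a; rewrite pm_rotations_image // SE; congr (imset _ (mem _)).
rewrite UE (cards0_eq cardF) setU0 /pm_set HE -HE -imset_comp.
by congr (_ :|: _); apply: eq_imset.
Qed.

Theorem proposition3p1 (n k : nat) (r s : 'D_(n.*2)) (S : {set 'D_(n.*2)})
    (hrs : dihedral_generators r s)
    (hS : S \subset rotation_set n r :\ 1%g)
    (hSinv : inverse_closed S)
    (hk : (2 <= k)%N)
    (hcard : #|S| = (2 * k)%N)
    (hkn : (2 * k < n)%N) :
  (exists a : 'I_k -> 'Z_n, S = pm_rotations r a) /\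
  forall (a : 'I_k -> 'Z_n) (z : 'I_k -> int),
    S = pm_rotations r a ->
    (forall i, (z i)%:~R = a i) ->
    let T := pm_set a in
    let G1 := cayley S in
    let G2 := cayleyZ T in
    let d := gcdn n (\big[gcdn/0%N]_(i < k) `|z i|%N) in
    [/\ graph_iso G1 (graph_sum G2 G2),
        d = 1%N -> graph_connected G2 /\ splits_into G1 2 G2
      & (1 < d)%N ->
        forall (n' : nat) (z' : 'I_k -> int),
          n = (d * n')%N ->
          (forall i, z i = d%:Z * z' i) ->
          let T' := pm_set (fun i => (z' i)%:~R : 'Z_n') in
          let G' := cayleyZ T' in
          splits_into G2 d G' /\ splits_into G1 (2 * d) G'].
Proof.
have n1 : (1 < n)%N by apply: leq_trans hkn; rewrite ltnS muln_gt0 (ltnW hk).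
have or := order_rotation n r s n1 hrs.
have cardD : #|{: 'D_(n.*2)}| = (2 * n)%N.
  by rewrite -cardsT card_dihedral // mul2n.
split; first exact: pm_rotations_exists n1 or hS hSinv hcard.
move=> a z SE za T G1 G2 d.
have iso12 : graph_iso (copies 2 G2) G1.
  by rewrite /G1 SE; apply: cayley_pm_copies.
split.
- exact: graph_iso_trans (graph_iso_sym _ _ _ _ iso12) (copies_sum _ _).
- move=> d1; suff conn2 : graph_connected G2.
    by split=> //; apply: copies_splits_into iso12 conn2.
  have := pm_cayley_connected n k z n1 d1.
  rewrite /G2 /T /pm_set.
  by congr (graph_connected (cayleyZ (_ :|: _))); apply: eq_imset => i; rewrite za.
move=> d_gt1 n' z' def_n def_z T' G'.
(* If [n'] were 1 then every [a i] would vanish and [S] would contain the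
   identity. *)
have n'_gt1 : (1 < n')%N.
  case: n' {T' G'} def_n => [|[|//]]; first by rewrite muln0 => n0; rewrite n0 in n1.
  rewrite muln1 => def_n.
  have i0 : 'I_k by exists 0%N; apply: ltnW.
  have a0 : a i0 = 0.
    by rewrite -za def_z -def_n intrM -pmulrn pchar_Zp // mul0r.
  have S1 : 1%g \in S.
    by rewrite SE; apply/setUP; left; apply/imsetP; exists i0; rewrite ?a0.
  by have := subsetP hS _ S1; rewrite !inE eqxx.
have conn' : graph_connected G'.
  apply: pm_cayley_connected => //; apply/eqP.
  rewrite -(eqn_pmul2l (ltnW d_gt1)) muln1 muln_gcdr -def_n.
  rewrite (big_morph (muln d) (muln_gcdr d) (muln0 d)).
  apply/eqP; congr gcdn; apply: eq_bigr => i _.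
  by rewrite def_z abszM.
have scale (gT : finGroupType) (g : gT) (c : nat) :
    #[g]%g = n -> #|gT| = (c * n')%N ->
    graph_iso (copies c G') (cayley (pm_rotations g a)).
  move=> og cardG; have gn : (g ^+ n = 1)%g by rewrite -og expg_order.
  rewrite (pm_rotations_scale gT n d n' k g a z') //; last first.
    by move=> i; rewrite -def_z za.
  apply: cayley_pm_copies => //.
  by rewrite orderXdiv og def_n ?dvdn_mulr // mulKn // ltnW.
split; apply: copies_splits_into conn'; last first.
  by rewrite /G1 SE; apply: scale; rewrite // cardD -mulnA -def_n.
rewrite /G2 /T -pm_rotations_Zp1; apply: scale.
  by rewrite order_Zp1 Zp_cast.
by rewrite card_ord Zp_cast.
Qed.
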